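(* There exists an absolute constant $m_0$ such that the following holds for every integer $m\ge m_0$. Let $q=2^m$, let $a,b,c\in\mathbb{F}_{q^3}$, and let $P_3(x)=ax^{2(q+1)}+bx^{2(q^2+q)}+cx^{2(q^2+1)}\in\mathbb{F}_{q^3}[x]$. Then $P_3$ is a planar function on $\mathbb{F}_{q^3}$ if and only if $b=0$ and $c=a^q$.
   Context: A function $f:\mathbb{F}_{2^n}\to\mathbb{F}_{2^n}$ is called planar if for every $a\in\mathbb{F}_{2^n}^{*}$ the map $x\mapsto f(x+a)+f(x)+ax$ is a permutation of $\mathbb{F}_{2^n}$. *)

(* Defs.v *)
From HB Require Import structures.
From mathcomp Require Import all_boot all_algebra all_field.
Set Implicit Arguments. Unset Strict Implicit. Unset Printing Implicit Defensive.
Import GRing.Theory.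
Local Open Scope ring_scope.

Definition planar (F : finFieldType) (f : F -> F) : Prop :=
  forall e : F, e != 0 -> bijective (fun x : F => f (x + e) + f x + e * x).

Definition P3 (F : finFieldType) (m : nat) (a b c : F) (x : F) : F :=
  let q := (2 ^ m)%N in
  a * x ^+ (2 * (q + 1)) + b * x ^+ (2 * (q ^ 2 + q)) + c * x ^+ (2 * (q ^ 2 + 1)).

(* Main.v *)
(* Write a, b, c as squares of al, be, ga, put L(w) = al w + be w^q + ga w^(q^2)
   and x ^ y = x y^q + x^q y.  Since P_3 is a square of a quadratic form over F_q,
   planarity says that x y = L(x ^ y)^2 has no solution with x, y nonzero.

   If be = 0 and ga = al^q, the relation yields N(x ^ y) = 0, whence x y = 0.

   Conversely let R(w) = w^q L(w) and S = Tr R, a ternary quadratic form over F_q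
   which vanishes identically only if be = 0 and ga = al^q.  For S(w) <> 0, a root
   z in F_q of z^2 + S z = sigma_2(R, R^q, R^(q^2)) splits L(w)^2, viewed as a
   binary quadratic form on the plane Tr(x w^q) = 0, and gives a solution with
   x ^ y proportional to w.  So suppose that sigma_2 / S^2 has absolute trace 1
   at all such w.  On a line p + y r with S constant and nonzero, sigma_2 / S^2 is
   a quartic polynomial in y; being of trace 1 on F_q it equals
   h^2 + h + constant for q >= 8, so it has trace 1 at all y in F_(q^3) as well.
   But at y = p/r, where the first of the three conjugate coordinates
   of p + y r vanishes, so does one of the three factors of sigma_2, and
   sigma_2 / S^2 = u^2 + u has trace 0.  Such a line joins the radical of the
   polar form of S to another point. *)
Require Import Defs.
From HB Require Import structures.
From mathcomp Require Import all_boot all_algebra all_field.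
From mathcomp Require Import ring zify.
Set Implicit Arguments. Unset Strict Implicit. Unset Printing Implicit Defensive.
Import GRing.Theory.
Local Open Scope ring_scope.

(** * Arithmetic in characteristic 2 and nonroots of sparse polynomials *)

Lemma char2_eq (R : pzRingType) (x y : R) : 2 = 0 :> R -> x + y = 0 -> x = y.
Proof.
by move=> h xy; rewrite -[x]addr0 -[0 in LHS](mul0r y) -h mulr_natl mulr2n addrA xy add0r.
Qed.

Lemma even_natr0 (R : pzRingType) : 2 = 0 :> R ->
  [/\ 4 = 0 :> R, 6 = 0 :> R, 8 = 0 :> R, 10 = 0 :> R & 12 = 0 :> R].
Proof.
have even n : 2 = 0 :> R -> (2 * n)%:R = 0 :> R by move=> h; rewrite natrM h mul0r.
by move=> h; split; [exact: (even 2) | exact: (even 3) | exact: (even 4)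
  | exact: (even 5) | exact: (even 6)].
Qed.

(* [ring: h] only rewrites coefficients equal to a given constant, hence one
   hypothesis per even coefficient. *)
Ltac ring2 h :=
  apply: (char2_eq h);
  let h4 := fresh in let h6 := fresh in let h8 := fresh in
  let h10 := fresh in let h12 := fresh in
  have [h4 h6 h8 h10 h12] := even_natr0 h;
  ring: h12 h10 h8 h6 h4 h.

Lemma poly_nonroot (F : finFieldType) (p : {poly F}) :
  p != 0 -> (size p <= #|F|)%N -> exists x, p.[x] != 0.
Proof.
move=> p0 sp; apply/existsP; apply: contraLR sp => /existsPn h.
rewrite -ltnNge cardE; apply: max_poly_roots => //; last exact: enum_uniq.
by apply/allP => x _; apply: negbNE (h x).
Qed.

(** The exponent [e] occurs only once, so its coefficient survives whatever coincidences there are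
    in [s], and the degree is below the field size. *)
Lemma sparse_nonroot (F : finFieldType) (c : F) e (s : seq (F * nat)) :
  c != 0 -> (e < #|F|)%N -> all (fun t => (t.2 != e) && (t.2 < #|F|)%N) s ->
  exists x, c * x ^+ e + \sum_(t <- s) t.1 * x ^+ t.2 != 0.
Proof.
move=> c0 eF /allP sF.
pose p := c *: 'X^e + \sum_(t <- s) t.1 *: 'X^(t.2).
have [||x] := @poly_nonroot F p.
- apply: contra_neq c0 => /(congr1 (fun r : {poly F} => r`_e)).
  rewrite coef0 coefD coefZ coefXn eqxx mulr1 coef_sum big1_seq ?addr0 // => t.
  by case/andP=> _ /sF /andP[te _]; rewrite coefZ coefXn eq_sym (negbTE te) mulr0.
- apply: (leq_trans (size_polyD _ _)); rewrite geq_max.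
  rewrite (leq_trans (size_scale_leq _ _)) ?size_polyXn //=.
  apply: (leq_trans (size_sum _ _ _)); apply/bigmax_leqP_seq => t t_s _; have /andP[_ tF] := sF t t_s.
  by rewrite (leq_trans (size_scale_leq _ _)) ?size_polyXn.
- rewrite !hornerE horner_sum => h; exists x; congr (_ != 0): h.
  by rewrite ?hornerXn; congr (_ + _); apply: eq_bigr => t _; rewrite hornerZ hornerXn.
Qed.

(** * Absolute trace and additive Hilbert 90 *)

Definition trace (F : finFieldType) n (z : F) : F := \sum_(i < n) z ^+ (2 ^ i).

Section Char2.

Variable F : finFieldType.
Hypothesis two0 : 2 = 0 :> F.

Lemma pchar2 : 2%N \in [pchar F].
Proof. by rewrite !inE /= two0. Qed.

Lemma frobD n (x y : F) : (x + y) ^+ (2 ^ n) = x ^+ (2 ^ n) + y ^+ (2 ^ n).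
Proof. by apply: exprDn_pchar; rewrite pnatX pnatE // pchar2. Qed.

Lemma sqr_sum n (f : 'I_n -> F) : (\sum_i f i) ^+ 2 = \sum_i f i ^+ 2.
Proof.
apply: (big_morph (fun x : F => x ^+ 2)) => [x y|]; last by rewrite expr0n.
by ring2 two0.
Qed.

Lemma traceD n : {morph @trace F n : x y / x + y}.
Proof.
by move=> x y; rewrite /trace -big_split; apply: eq_bigr => i _; exact: frobD.
Qed.

Lemma traceX2 n (x : F) : trace n x ^+ 2 = trace n (x ^+ 2).
Proof.
by rewrite /trace sqr_sum; apply: eq_bigr => i _; rewrite -!exprM mulnC.
Qed.

Lemma trace_telescope n (x : F) : trace n (x ^+ 2) + trace n x = x ^+ (2 ^ n) + x.
Proof.
elim: n => [|n IH]; first by rewrite /trace !big_ord0 expn0 expr1; ring2 two0.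
rewrite /trace !big_ord_recr /= -!/(trace _ _) -exprM -expnS.
transitivity (trace n (x ^+ 2) + trace n x + x ^+ (2 ^ n) + x ^+ (2 ^ n.+1)).
  by ring.
by rewrite IH; ring2 two0.
Qed.

Lemma trace_sqr n (x : F) : x ^+ (2 ^ n) = x -> trace n (x ^+ 2) = trace n x.
Proof. by move=> h; apply: char2_eq => //; rewrite trace_telescope h; ring2 two0. Qed.

Lemma trace_bit n (x : F) : x ^+ (2 ^ n) = x -> trace n x != 0 -> trace n x = 1.
Proof.
move=> h t0; apply: (mulfI t0); rewrite mulr1 -expr2 traceX2; exact: trace_sqr.
Qed.

Lemma hilbert90_add n (t h : F) :
  t ^+ (2 ^ n) = t -> trace n t = 1 -> trace n h = 0 -> exists z, z ^+ 2 + z = h.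
Proof.
(* Squaring shifts the index of t^(2^i), and Tr_(i+1)(h) = h + Tr_i(h)^2, so z^2 + z collapses to h
   Tr(t)^2; [h0] closes the shift at i = n. *)
move=> tn t1 h0; exists (\sum_(i < n) t ^+ (2 ^ i) * trace i h).
set z := \sum_(i < n) _.
have z1 : z = \sum_(i < n) t ^+ (2 ^ i.+1) * trace i.+1 h.
  have: \sum_(i < n.+1) t ^+ (2 ^ i) * trace i h = z.
    by rewrite big_ord_recr /= h0 mulr0 addr0.
  by rewrite big_ord_recl /= {1}/trace big_ord0 mulr0 add0r => <-.
rewrite {2}z1 /z sqr_sum -big_split /=.
transitivity (\sum_(i < n) (t ^+ (2 ^ i)) ^+ 2 * h).
  apply: eq_bigr => i _.
  have -> : trace i.+1 h = h + trace i h ^+ 2.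
    rewrite traceX2 /trace big_ord_recl expn0 expr1; congr (_ + _).
    by apply: eq_bigr => j _; rewrite -exprM -expnS.
  by rewrite expnSr exprM; ring2 two0.
rewrite -mulr_suml.
have -> : \sum_(i < n) (t ^+ (2 ^ i)) ^+ 2 = trace n t ^+ 2.
  by rewrite traceX2; apply: eq_bigr => i _; rewrite -!exprM mulnC.
by rewrite t1 expr1n mul1r.
Qed.

End Char2.

(** * Frobenius and traces of F_(q^3) over F_q *)

Fact frob_key : unit. Proof. exact: tt. Qed.

(* Locked, since otherwise [frX] would rewrite [frob m (frob m x)]. *)
Definition frob (F : finFieldType) m (x : F) : F := locked_with frob_key (x ^+ (2 ^ m)).

Section CubicExtension.

Variables (F : finFieldType) (m : nat).
Hypothesis cardF : #|F| = ((2 ^ m) ^ 3)%N.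
Hypothesis m3 : (2 < m)%N.

Local Notation fr := (@frob F m).
Local Notation tr3 x := (x + fr x + fr (fr x)).

Lemma cubic_two0 : 2 = 0 :> F.
Proof.
have : 2%N \in [pchar F].
  by apply: (@card_finPcharP F 2 (m * 3)); rewrite // cardF expnM.
by move/andP=> [_ /eqP].
Qed.

Let two0 := cubic_two0.

Lemma card_exp : (2 ^ (m + m + m) = #|F|)%N.
Proof. by rewrite cardF -expnM; congr (2 ^ _)%N; lia. Qed.

Lemma expr_card_exp (x : F) : x ^+ (2 ^ (m + m + m)) = x.
Proof. by rewrite card_exp expf_card. Qed.

Lemma frobE (x : F) : fr x = x ^+ (2 ^ m).
Proof. exact: unlock. Qed.

Lemma fr0 : fr 0 = 0.
Proof. by rewrite !frobE expr0n expn_eq0. Qed.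

Lemma fr1 : fr 1 = 1.
Proof. by rewrite frobE expr1n. Qed.

Lemma frD x y : fr (x + y) = fr x + fr y.
Proof. by rewrite !frobE; apply: frobD. Qed.

Lemma frM x y : fr (x * y) = fr x * fr y.
Proof. by rewrite !frobE exprMn. Qed.

Lemma frX x n : fr (x ^+ n) = fr x ^+ n.
Proof. by rewrite !frobE -!exprM mulnC. Qed.

Lemma frV x : fr x^-1 = (fr x)^-1.
Proof. by rewrite !frobE exprVn. Qed.

Lemma fr3 x : fr (fr (fr x)) = x.
Proof. by rewrite !frobE -!exprM -!expnD addnA expr_card_exp. Qed.

Lemma fr_eq0 x : (fr x == 0) = (x == 0).
Proof. by rewrite !frobE expf_eq0 expn_gt0. Qed.

Definition frE := (frD, frM, frX, frV, fr3, fr0, fr1).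

Lemma tr3D x y : tr3 (x + y) = tr3 x + tr3 y.
Proof. by rewrite !frE; ring. Qed.

Lemma tr3Ml h x : fr h = h -> tr3 (h * x) = h * tr3 x.
Proof. by move=> hh; rewrite !frE !hh; ring. Qed.

Lemma fr_tr3 x : fr (tr3 x) = tr3 x.
Proof. by rewrite !frE; ring. Qed.

(** Transitivity of traces: [trace m] is the absolute trace of F_q, [trace (m + m + m)] that of
    F_(q^3). *)
Lemma trace_tr3 (z : F) : trace m (tr3 z) = trace (m + m + m) z.
Proof.
have tr_fr n (x : F) : trace (m + n) x = trace m x + trace n (fr x).
  rewrite /trace big_split_ord /=; congr (_ + _); apply: eq_bigr => i _.
  by rewrite frobE -exprM -expnD.
by rewrite -addnA !tr_fr !traceD // !addrA.
Qed.

Lemma trace_neq0 : exists z : F, trace (m + m + m) z != 0.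
Proof.
pose s := [seq (1 : F, (2 ^ i.+1)%N) | i <- iota 0 (m + m + m).-1].
have N0 : (0 < m + m + m)%N by lia.
have [||z] := @sparse_nonroot F 1 1 s (oner_neq0 _).
- by rewrite -card_exp -[X in (X < _)%N](expn0 2) ltn_exp2l.
- apply/allP => _ /mapP[i i_lt ->]; rewrite mem_iota in i_lt.
  by rewrite -card_exp -[X in _ != X](expn0 2) eqn_exp2l // ltn_exp2l //; lia.
- rewrite big_map mul1r expr1 => h; exists z; congr (_ != 0): h.
  rewrite /trace -[in RHS](prednK N0) big_ord_recl expn0 expr1; congr (_ + _).
  rewrite -[X in iota 0 X]subn0 big_mkord.
  by apply: eq_bigr => i _; rewrite mul1r.
Qed.

Lemma trace_normal : exists t, fr t = t /\ trace m t = 1.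
Proof.
have [z z0] := trace_neq0; exists (tr3 z); split; first exact: fr_tr3.
by rewrite -trace_tr3 in z0; apply: trace_bit => //; rewrite -frobE fr_tr3.
Qed.

Lemma trace_nondeg h : fr h = h -> (forall z, fr z = z -> trace m (h * z) = 0) -> h = 0.
Proof.
move=> hh H; apply/eqP; apply: contraTT isT => h0.
have [t t0] := trace_neq0.
have := H _ (fr_tr3 (t / h)); rewrite -tr3Ml // trace_tr3 mulrC divfK //.
by move/eqP; rewrite (negbTE t0).
Qed.

Lemma fr_sqrt z : fr z = z -> exists2 y, fr y = y & y ^+ 2 = z.
Proof.
move=> hz; exists (z ^+ (2 ^ m.-1)); first by rewrite frX hz.
by rewrite -exprM -expnSr prednK -?frobE //; lia.
Qed.

Lemma sqrt_exists (z : F) : exists y, y ^+ 2 = z.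
Proof.
exists (z ^+ (2 ^ (m + m + m).-1)); rewrite -exprM -expnSr prednK //; last lia.
exact: expr_card_exp.
Qed.

Lemma artin_schreier h : fr h = h -> trace m h = 0 -> exists2 z, fr z = z & z ^+ 2 + z = h.
Proof.
move=> hh h0; have [t [ht t1]] := trace_normal.
rewrite frobE in ht; have [z zh] := hilbert90_add two0 ht t1 h0; exists z => //.
(* By telescoping, z^q + z = Tr(z^2 + z) = Tr(h) = 0, so z lies in F_q. *)
apply: char2_eq => //; rewrite frobE -trace_telescope //.
by rewrite -traceD // zh.
Qed.

(** * Sparse polynomials over F_(q^3) and quartics of constant trace *)

Local Notation q := (2 ^ m)%N.

Lemma card_gt : (7 < q)%N.
Proof. by rewrite (@leq_exp2l 2 3). Qed.

Lemma cardqqq : #|F| = (q * q * q)%N.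
Proof. by rewrite cardF !expnS expn0 muln1 mulnA. Qed.

Lemma fr_frE (x : F) : fr (fr x) = x ^+ (q * q).
Proof. by rewrite !frobE exprM. Qed.

Lemma frob_nontrivial : exists u : F, fr u != u.
Proof.
have q8 := card_gt.
have [||u] := @sparse_nonroot F 1 1 [:: (1, q)] (oner_neq0 _).
- by rewrite cardqqq; nia.
- by rewrite /= cardqqq; nia.
- rewrite big_cons big_nil /= addr0 !mul1r expr1 -frobE => h; exists u.
  by apply: contra_neq h => ->; ring2 two0.
Qed.

(** Some y in F_q lies outside F_4: as a polynomial in u, Tr(u)^4 + Tr(u) has a lone linear term,
    and its degree 4q^2 is below q^3 because q >= 8. *)
Lemma fixed_quartic : exists y : F, fr y = y /\ y ^+ 4 != y.
Proof.
have q8 := card_gt.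
pose s := [:: (1 : F, q); (1, (q * q)%N); (1, 4%N); (1, (4 * q)%N); (1, (4 * (q * q))%N)].
have [||u] := @sparse_nonroot F 1 1 s (oner_neq0 _).
- by rewrite cardqqq; nia.
- by rewrite /= cardqqq !andbT; apply/and5P; split; nia.
- rewrite !big_cons big_nil /= addr0 !mul1r expr1 => h; exists (tr3 u).
  split; first exact: fr_tr3.
  apply: contra_neq h => h; rewrite (mulnC 4 q) (mulnC 4 (q * q)%N).
  rewrite (exprM _ q 4) (exprM _ (q * q)%N 4) -!fr_frE -!frobE.
  transitivity (tr3 u ^+ 4 + tr3 u); last by rewrite h; ring2 two0.
  by ring2 two0.
Qed.

Lemma hilbert90_mul (k : F) :
  k * fr k * fr (fr k) = 1 -> exists2 z, z != 0 & fr z = k * z.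
Proof.
move=> k1; have q8 := card_gt.
have [||t] := @sparse_nonroot F 1 1 [:: (k^-1, q); ((k * fr k)^-1, (q * q)%N)] (oner_neq0 _).
- by rewrite cardqqq; nia.
- by rewrite /= cardqqq; nia.
- rewrite !big_cons big_nil /= addr0 mul1r expr1 -frobE -fr_frE => h.
  (* A Lagrange resolvent, nonzero by the choice of t. *)
  exists (t + (k^-1 * fr t + (k * fr k)^-1 * fr (fr t))) => //.
  have k0 : k != 0.
    by apply: contra_eq_neq k1 => ->; rewrite !mul0r eq_sym oner_neq0.
  have kk : (fr k * fr (fr k))^-1 = k.
    have P0 : fr k * fr (fr k) != 0 by rewrite mulf_neq0 ?fr_eq0.
    by apply: (mulIf P0); rewrite mulVf // mulrA.
  rewrite !frE kk; field.
  by rewrite fr_eq0 k0.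
Qed.

(** Constant trace on F_q forces c3 = 0 and c1^4 + c2^2 + c4 = 0. These are identities between
    coefficients, so the trace is constant on F_(q^3) too. *)
Lemma trace_fixed_quartic (c0 c1 c2 c3 c4 : F) :
  fr c0 = c0 -> fr c1 = c1 -> fr c2 = c2 -> fr c3 = c3 -> fr c4 = c4 ->
  (forall y, fr y = y ->
     trace m (c0 + c1 * y + c2 * y ^+ 2 + c3 * y ^+ 3 + c4 * y ^+ 4) != 0) ->
  forall y, trace (m + m + m) (c0 + c1 * y + c2 * y ^+ 2 + c3 * y ^+ 3 + c4 * y ^+ 4) = 1.
Proof.
move=> h0 h1 h2 h3 h4 H.
have sqr_m (x : F) : fr x = x -> trace m (x ^+ 2) = trace m x.
  by rewrite frobE; apply: trace_sqr.
have sqr_F (x : F) : trace (m + m + m) (x ^+ 2) = trace (m + m + m) x.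
  by apply: trace_sqr => //; exact: expr_card_exp.
have t0 : trace m c0 = 1.
  have := H 0 fr0; rewrite !expr0n !mulr0 !addr0 => /trace_bit -> //.
  by rewrite -frobE.
pose g y := c1 * y + c2 * y ^+ 2 + c3 * y ^+ 3 + c4 * y ^+ 4.
have H0 y : fr y = y -> trace m (g y) = 0.
  move=> hy; apply: (addrI (trace m c0)); rewrite addr0 -traceD // t0 /g !addrA trace_bit //.
  - rewrite -frobE !frE h0 h1 h2 h3 h4 hy //.
  - exact: H.
have gD y z : g (y + z) = g y + g z + (c3 * y ^+ 2 * z + c3 * y * z ^+ 2).
  by rewrite /g; ring2 two0.
(* Polarizing and moving both traces to z^2. *)
have c3y y : fr y = y -> c3 ^+ 2 * y ^+ 4 + c3 * y = 0.
  move=> hy; apply: trace_nondeg; first by rewrite !frE h3 hy.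
  move=> z2 /fr_sqrt [z hz <-].
  have := H0 (y + z); rewrite frD hy hz gD traceD // traceD // !H0 // !add0r => /(_ erefl) <-.
  rewrite [RHS]traceD // -(@sqr_m (c3 * y ^+ 2 * z)) ?frE ?h3 ?hy ?hz // -traceD //.
  by congr trace; ring.
have c30 : c3 = 0.
  apply/eqP; apply: contraTT isT => c30.
  have c31 : c3 = 1.
    apply: (mulIf c30); apply: char2_eq => //.
    by have := c3y 1 fr1; rewrite !expr1n !mulr1 mul1r expr2.
  have [y [hy /eqP[]]] := fixed_quartic.
  by apply: char2_eq => //; have := c3y y hy; rewrite c31 expr1n !mul1r.
have d0 : c1 ^+ 4 + c2 ^+ 2 + c4 = 0.
  apply: trace_nondeg; first by rewrite !frE h1 h2 h4.
  (* Every element of F_q is a fourth power y^4, and squaring inside the trace moves all terms of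
     g(y) to y^4. *)
  move=> z2 /fr_sqrt [z hz <-]; have [y hy <-] := fr_sqrt hz.
  have := H0 y hy; rewrite /g c30 mul0r addr0 !traceD //.
  rewrite -(sqr_m (c1 * y)) -?(sqr_m ((c1 * y) ^+ 2)) -?(sqr_m (c2 * y ^+ 2)) ?frE ?h1 ?h2 ?hy //.
  by rewrite -!traceD // => <-; congr trace; ring.
move=> y; rewrite c30 mul0r addr0 !traceD //.
rewrite -(sqr_F (c1 * y)) -(sqr_F ((c1 * y) ^+ 2)) -(sqr_F (c2 * y ^+ 2)) -!addrA -!traceD //.
have -> : ((c1 * y) ^+ 2) ^+ 2 + ((c2 * y ^+ 2) ^+ 2 + c4 * y ^+ 4)
   = (c1 ^+ 4 + c2 ^+ 2 + c4) * y ^+ 4 by ring.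
(* Only c0 is left; its trace from F_(q^3) is 3 Tr(c0) = 1. *)
rewrite d0 mul0r addr0 -trace_tr3 !h0.
by rewrite !traceD // t0; ring2 two0.
Qed.

(** * Sigma_2 along a line on which S is constant *)

Local Notation wedge x y := (x * fr y + fr x * y).
Local Notation e2 x := (x * fr x + fr x * fr (fr x) + fr (fr x) * x).

Lemma fr_e2 x : fr (e2 x) = e2 x.
Proof. by rewrite !frE; ring. Qed.

Lemma pencil_point (A B C y0 : F) :
  tr3 A != 0 -> tr3 B = 0 -> tr3 C = 0 ->
  fr (fr A) + fr (fr B) * y0 + fr (fr C) * y0 ^+ 2 = 0 ->
  exists y z, [/\ fr y = y, fr z = z &
    z ^+ 2 + tr3 A * z = e2 (A + B * y + C * y ^+ 2)].
Proof.
move=> s0 trB trC hy0; set s := tr3 A in s0 *.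
have hs : fr s = s by exact: fr_tr3.
have [w [wE hw]] : exists w, w = (s ^+ 2)^-1 /\ fr w = w.
  by exists (s ^+ 2)^-1; rewrite frV frX hs.
pose R y := A + B * y + C * y ^+ 2.
have [/existsP[y /andP[/eqP hy /eqP ty]]|] :=
    boolP [exists y, (fr y == y) && (trace m (e2 (R y) * w) == 0)].
  have [|z hz zE] := @artin_schreier (e2 (R y) * w) _ ty.
    by rewrite frM fr_e2 hw.
  exists y, (s * z); split => //; first by rewrite frM hs hz.
  transitivity ((z ^+ 2 + z) * s ^+ 2); first by ring.
  by rewrite zE wE mulrAC -mulrA divff ?mulr1 // expf_neq0.
move=> /existsPn none.
(* The polarization of [e2]. *)
pose mix X Y := X * (fr Y + fr (fr Y)) + fr X * (Y + fr (fr Y)) + fr (fr X) * (Y + fr Y).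
have hmix X Y : fr (mix X Y * w) = mix X Y * w by rewrite /mix !frE hw; ring.
have he2 X : fr (e2 X * w) = e2 X * w by rewrite frM fr_e2 hw.
have h2 : fr ((e2 B + mix A C) * w) = (e2 B + mix A C) * w.
  by rewrite mulrDl frD he2 hmix.
(* Only the coefficients are conjugated in [r1] and [r2]: these are conjugates of [R y] for y in
   F_q, but the identity holds at every y, in particular at [y0]. *)
have expand y (r0 := R y) (r1 := fr A + fr B * y + fr C * y ^+ 2)
    (r2 := fr (fr A) + fr (fr B) * y + fr (fr C) * y ^+ 2) :
  (r0 * r1 + r1 * r2 + r2 * r0) * w =
  e2 A * w + mix A B * w * y + (e2 B + mix A C) * w * y ^+ 2
  + mix B C * w * y ^+ 3 + e2 C * w * y ^+ 4.
  by rewrite /r0 /r1 /r2 /R /mix; ring.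
have := @trace_fixed_quartic _ _ _ _ _ (he2 A) (hmix A B) h2 (hmix B C) (he2 C) _ y0.
rewrite -expand hy0 mulr0 mul0r !addr0 => tr1.
have : 1 = 0 :> F.
  rewrite -tr1 => [|y hy]; last first.
    rewrite -expand; have := none y; rewrite hy eqxx /= /R.
    by rewrite !frE !hy.
  (* By [hy0] only one term of the symmetric function survives at y0. *)
  pose u := R y0 / s.
  have -> : R y0 * (fr A + fr B * y0 + fr C * y0 ^+ 2) * w = u ^+ 2 + u.
    (* The three conjugate polynomials sum to s identically, and the third vanishes at [y0]. *)
    have -> : fr A + fr B * y0 + fr C * y0 ^+ 2 = s + R y0.
      apply: char2_eq => //.
      transitivity (2 * tr3 A + tr3 B * y0 + tr3 C * y0 ^+ 2
         + (fr (fr A) + fr (fr B) * y0 + fr (fr C) * y0 ^+ 2)); last first.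
        by rewrite hy0 trB trC two0 !mul0r !addr0.
      by rewrite /R /s; ring2 two0.
    by rewrite /u wE; field.
  rewrite traceD // trace_sqr //; first by ring2 two0.
  exact: expr_card_exp.
by move/eqP; rewrite oner_eq0.
Qed.

(** * The ternary quadratic form S = Tr R *)

Section Form.

Variables al be ga : F.

Definition form w := fr w * (al * w + be * fr w + ga * fr (fr w)).

Definition polar w u := fr w * (al * u + be * fr u + ga * fr (fr u))
  + fr u * (al * w + be * fr w + ga * fr (fr w)).

Lemma polarC w u : polar w u = polar u w.
Proof. exact: addrC. Qed.

Lemma formD p r y : fr y = y ->
  form (p + y * r) = form p + polar p r * y + form r * y ^+ 2.
Proof. by move=> hy; rewrite /form /polar !frE !hy; ring. Qed.

Lemma tr3_formD p r y : fr y = y -> tr3 (polar p r) = 0 ->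
  tr3 (form (p + y * r)) = tr3 (form p) + y ^+ 2 * tr3 (form r).
Proof.
move=> hy pr0; rewrite formD // !tr3D.
rewrite (mulrC (polar p r)) (mulrC (form r)) (@tr3Ml y (polar p r)) //.
by rewrite (@tr3Ml (y ^+ 2) (form r)) ?frX ?hy // pr0 mulr0 addr0.
Qed.

Lemma isotropic_point p r :
  r != 0 -> tr3 (form p) != 0 -> tr3 (form r) = 0 -> tr3 (polar p r) = 0 ->
  exists w z, [/\ tr3 (form w) != 0, fr z = z & z ^+ 2 + tr3 (form w) * z = e2 (form w)].
Proof.
move=> r0 p0 hr hpr.
have [||||y [z [hy hz zE]]] := @pencil_point (form p) (polar p r) (form r) (p / r).
- by [].
- by [].
- by [].
(* The second conjugate of R(p + y r) has the factor p + y r, which is 2p = 0 at y = p/r. *)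
- by rewrite /form /polar !frE; transitivity (2 * (p * (fr (fr al) * fr (fr p) + fr (fr be) * p + fr (fr ga) * fr p)
  + p ^+ 2 / r * (fr (fr al) * fr (fr r) + fr (fr be) * r + fr (fr ga) * fr r))); [field | rewrite two0 mul0r].
- exists (p + y * r), z; rewrite tr3_formD // hr mulr0 addr0; split => //.
  by rewrite formD.
Qed.

Lemma tr3_form w (a := al + fr (fr ga)) : tr3 (form w) =
  a * (w * fr w) + fr a * (fr w * fr (fr w)) + fr (fr a) * (fr (fr w) * w)
  + (be * fr w ^+ 2 + fr be * fr (fr w) ^+ 2 + fr (fr be) * w ^+ 2).
Proof. by rewrite /a /form !frE; ring. Qed.

(** As a polynomial in w, S has coefficient al + ga^(q^2) at w^(q+1) and be at w^(2q), and all its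
    exponents are distinct and below q^3. *)
Lemma form_nonzero : (al + fr (fr ga) != 0) || (be != 0) -> exists p, tr3 (form p) != 0.
Proof.
have q8 := card_gt.
have [a0 /= be0|a0 _] := eqVneq (al + fr (fr ga)) 0.
  have [||p] := @sparse_nonroot F be (2 * q) [:: (fr be, (2 * (q * q))%N); (fr (fr be), 2%N)] be0.
  - by rewrite cardqqq; nia.
  - by rewrite /= cardqqq !andbT; apply/andP; split; nia.
  - rewrite !big_cons big_nil /= addr0 (mulnC 2 q) (mulnC 2 (q * q)%N).
    rewrite (exprM _ q) (exprM _ (q * q)%N 2) -fr_frE -frobE => h; exists p.
    rewrite tr3_form a0 !fr0; congr (_ != 0): h; ring.
pose a := al + fr (fr ga).
have [||p] := @sparse_nonroot F a (q + 1) [:: (fr a, (q * q + q)%N); (fr (fr a), (q * q + 1)%N);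
    (be, (2 * q)%N); (fr be, (2 * (q * q))%N); (fr (fr be), 2%N)] a0.
- by rewrite cardqqq; nia.
- by rewrite /= cardqqq !andbT; apply/and5P; split; nia.
- rewrite !big_cons big_nil /= addr0 (mulnC 2 q) (mulnC 2 (q * q)%N) !exprD.
  rewrite (exprM _ q 2) (exprM _ (q * q)%N 2) -fr_frE -frobE => h; exists p.
  by rewrite tr3_form -/a; congr (_ != 0): h; ring.
Qed.

(** The polar form of S is alternating on a space of dimension 3 over F_q, hence degenerate; an
    explicit radical vector is given. *)
Lemma form_radical : exists2 n, n != 0 & forall w, tr3 (polar n w) = 0.
Proof.
pose a := al + fr (fr ga).
have alE : al = a + fr (fr ga) by rewrite /a; ring2 two0.
have [a0|a0] := eqVneq a 0.
  exists 1 => [|w]; first exact: oner_neq0.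
  by rewrite /polar alE a0 !frE; ring2 two0.
(* n is radical as soon as a n^(q+1) lies in F_q; here it is the norm of a. *)
exists (fr a) => [|w]; first by rewrite fr_eq0.
by move: (a) alE => a' alE; rewrite /polar alE !frE; ring2 two0.
Qed.

Lemma form_point : (al + fr (fr ga) != 0) || (be != 0) ->
  exists w z, [/\ tr3 (form w) != 0, fr z = z & z ^+ 2 + tr3 (form w) * z = e2 (form w)].
Proof.
move=> /form_nonzero [p p0]; have [n n0 rad] := form_radical.
have [Sn0|Sn0] := eqVneq (tr3 (form n)) 0.
  apply: (isotropic_point n0 p0 Sn0).
  by rewrite polarC.
(* Take n as base point. As n is radical, S(u n + y n) = S(u n) + y^2 S(n), so a square root y in
   F_q makes the direction (u + y) n isotropic; it is nonzero since u is not in F_q. *)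
have [u hu] := frob_nontrivial.
have [|y hy y2] := @fr_sqrt (tr3 (form (u * n)) / tr3 (form n)).
  by rewrite frM frV !fr_tr3.
apply: (@isotropic_point n (u * n + y * n)) => //.
- rewrite -mulrDl mulf_neq0 //; apply: contra_neq hu => uy.
  by rewrite (char2_eq two0 uy).
- rewrite tr3_formD //; last by rewrite polarC.
  by rewrite y2 divfK //; ring2 two0.
Qed.

(** * From a root z to a solution of x y = L(x ^ y)^2 *)

Definition linpart w := al * w + be * fr w + ga * fr (fr w).

Lemma linpartZ c w : fr c = c -> linpart (c * w) = c * linpart w.
Proof. by move=> hc; rewrite /linpart !frE !hc; ring. Qed.

Lemma linpartD v w : linpart (v + w) = linpart v + linpart w.
Proof. by rewrite /linpart !frE; ring. Qed.

(** With D = z + R^(q^2), the equation for z says that D has the norm of R and that D and R R^q / D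
    sum to s. Hilbert 90 gives t^(q-1) = R^q / D, and t fixes the ratio of x to y. *)
Lemma wedge_point w z : tr3 (form w) != 0 -> fr z = z ->
  z ^+ 2 + tr3 (form w) * z = e2 (form w) ->
  exists x y, [/\ x != 0, y != 0 & x * y = linpart (wedge x y) ^+ 2].
Proof.
set s := tr3 (form w) => s0 hz zE.
have RE : form w = fr w * linpart w by [].
have [w0 Q0] : w != 0 /\ linpart w != 0.
  apply/andP; rewrite -negb_or; apply: contra s0 => /orP[]/eqP h;
  by rewrite /s RE h !frE; apply/eqP; ring.
have w10 : fr w != 0 by rewrite fr_eq0.
have w20 : fr (fr w) != 0 by rewrite !fr_eq0.
have hs : fr s = s by exact: fr_tr3.
have sE : s = tr3 (form w) by [].
move: s (form w) RE sE s0 hs zE => s R RE sE s0 hs zE.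
(* Otherwise R = z lies in F_q, the equation reads z^2 + 3z^2 = 3z^2, and z = 0 gives s = 0. *)
have D0 : z + fr (fr R) != 0.
  apply/eqP => /(char2_eq two0) zR.
  have R0 : R = z by rewrite -[R]fr3 -zR hz.
  move: s0; rewrite sE; move: zE; rewrite sE R0 !hz => zE.
  have z0 : z ^+ 2 = 0.
    transitivity (z ^+ 2 + (z + z + z) * z + (z * z + z * z + z * z)); first by ring2 two0.
    by rewrite zE; ring2 two0.
  by move/eqP: z0; rewrite expf_eq0 /= => /eqP->; rewrite !addr0 eqxx.
set D := z + fr (fr R) in D0.
have frD1 : fr D = z + R by rewrite /D !frE hz.
have frD2 : fr (fr D) = z + fr R by rewrite frD1 frD hz.
have normD : D * fr D * fr (fr D) = R * fr R * fr (fr R).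
  rewrite frD2 frD1 /D.
  transitivity (z * (z ^+ 2 + s * z + e2 R) + R * fr R * fr (fr R)).
    by rewrite sE; ring.
  by rewrite zE; ring2 two0.
have DE : s = D + R * fr R / D.
  apply: (mulIf D0); rewrite mulrDl divfK //; apply: char2_eq => //.
  transitivity (z ^+ 2 + s * z + e2 R); last by rewrite zE; ring2 two0.
  by rewrite /D sE; ring2 two0.
have [|t t0 tE] := @hilbert90_mul (fr R / D).
- have nD0 : D * fr D * fr (fr D) != 0 by rewrite !mulf_neq0 ?fr_eq0.
  rewrite !(frM, frV, fr3) -[RHS](divff nD0) {1}normD; field.
  by rewrite !fr_eq0 D0.
have R0 : fr R != 0.
  apply: contraNneq t0 => R0; rewrite R0 !mul0r in tE.
  by rewrite -fr_eq0 tE.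
(* For the x and y below, x ^ y = c^2 s^2 / (w^q w^(q^2)); this c makes it c w, while x y = c^2
   L(w)^2. *)
have [c [cE hc c0]] : exists c, [/\ c = w * fr w * fr (fr w) / s ^+ 2, fr c = c & c != 0].
  exists (w * fr w * fr (fr w) / s ^+ 2); split=> //; last first.
    by rewrite !mulf_neq0 ?invr_eq0 ?expf_neq0.
  by rewrite frM frV frX hs !frM fr3; congr (_ / _); ring.
have QE : linpart w = R / fr w by rewrite RE mulrC mulKf.
pose x := c ^+ 2 * t ^+ 2 / fr w.
pose y := linpart w ^+ 2 * fr w / t ^+ 2.
exists x, y; split.
- by rewrite !mulf_neq0 ?invr_eq0 ?expf_neq0.
- by rewrite !mulf_neq0 ?invr_eq0 ?expf_neq0.
have -> : wedge x y = c * w.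
  have -> : c * w = c ^+ 2 * s ^+ 2 / (fr w * fr (fr w)).
    by rewrite cE; field; rewrite s0 w10 w20.
  rewrite /x /y QE !(frM, frV, frX) hc tE DE.
  have -> : (D + R * fr R / D) ^+ 2 = D ^+ 2 + (R * fr R / D) ^+ 2 by ring2 two0.
  by field; rewrite t0 w10 w20 D0 R0.
rewrite linpartZ // /x /y; field.
by rewrite t0 w10.
Qed.

(** * Planarity of P_3 *)

Lemma P3_diff x e :
  P3 m (al ^+ 2) (be ^+ 2) (ga ^+ 2) (x + e) + P3 m (al ^+ 2) (be ^+ 2) (ga ^+ 2) x
  = P3 m (al ^+ 2) (be ^+ 2) (ga ^+ 2) e + linpart (wedge x e) ^+ 2.
Proof.
have P3E u : P3 m (al ^+ 2) (be ^+ 2) (ga ^+ 2) u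
    = (al * (u * fr u) + be * (fr u * fr (fr u)) + ga * (u * fr (fr u))) ^+ 2.
  rewrite /P3 /= -mulnn !(mulnC 2) !(exprM u _ 2) !exprD expr1 -fr_frE -!frobE.
  by ring2 two0.
by rewrite !P3E /linpart !frE; ring2 two0.
Qed.

End Form.

(** The conjugates of x ^ e are the coordinates of the cross product of the conjugate vectors of x
    and e. It is orthogonal to both vectors; multiplying the two orthogonality relations gives the
    identity. *)
Lemma wedge_cubic x e :
  let c := wedge x e in
  c * fr c * fr (fr c) = x * e * fr c ^+ 2 + fr (x * e) * fr (fr c) ^+ 2
    + fr (fr (x * e)) * c ^+ 2.
Proof. by rewrite /= !frE; ring2 two0. Qed.

Lemma wedge_anisotropic al e x : e != 0 ->
  x * e = linpart al 0 (fr al) (wedge x e) ^+ 2 -> x = 0.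
Proof.
move=> e0 xe; have := wedge_cubic x e; rewrite /= xe.
move: (wedge x e) xe => c xe.
(* This is S(c)^2, and S vanishes identically for these coefficients. *)
have -> : linpart al 0 (fr al) c ^+ 2 * fr c ^+ 2
   + fr (linpart al 0 (fr al) c ^+ 2) * fr (fr c) ^+ 2
   + fr (fr (linpart al 0 (fr al) c ^+ 2)) * c ^+ 2 = 0.
  by rewrite /linpart !frE; ring2 two0.
move/eqP; rewrite !mulf_eq0 !fr_eq0 !orbb => /eqP c0.
move: xe; rewrite c0 /linpart !fr0 !mulr0 !addr0 expr0n => /eqP.
by rewrite mulf_eq0 (negbTE e0) orbF => /eqP.
Qed.

Lemma planar_P3 (a b c : F) : planar (P3 m a b c) <-> b = 0 /\ c = a ^+ (2 ^ m).
Proof.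
have [al <-] := sqrt_exists a; have [be <-] := sqrt_exists b.
have [ga <-] := sqrt_exists c; rewrite -frobE frX; split=> [planarP|[be0 gaE]].
  have [h|] := boolP ((al + fr (fr ga) != 0) || (be != 0)).
    have [w [z [Sw hz zE]]] := form_point h.
    have [x [y [x0 y0 xy]]] := wedge_point Sw hz zE.
    (* For e = y the map takes the value P_3(y) at both x and 0. *)
    have /bij_inj/(_ x 0) := planarP y y0.
    rewrite !P3_diff -xy => xE; case/eqP: x0; apply: xE.
    by rewrite /linpart !(fr0, mul0r, mulr0, addr0, add0r) expr0n addr0; ring2 two0.
  rewrite negb_or !negbK => /andP[/eqP h /eqP ->].
  rewrite expr0n; split=> //; congr (_ ^+ 2).
  by rewrite (char2_eq two0 h) fr3.
have {}be0 : be = 0 by apply/eqP; move/eqP: be0; rewrite expf_eq0.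
have {}gaE : ga = fr al.
  apply: char2_eq => //; apply/eqP.
  have : (ga + fr al) ^+ 2 = 0.
    by transitivity (ga ^+ 2 + fr al ^+ 2); [ring2 two0 | rewrite gaE; ring2 two0].
  by move/eqP; rewrite expf_eq0.
subst be ga => e e0; apply: injF_bij => x y; rewrite !P3_diff => xy.
apply: char2_eq => //; apply: (wedge_anisotropic (al := al) e0).
have -> : wedge (x + y) e = wedge x e + wedge y e by rewrite frD; ring.
rewrite linpartD; set X := linpart _ _ _ _ in xy *; set Y := linpart _ _ _ (_ + _) in xy *.
have {}xy : X ^+ 2 + e * x = Y ^+ 2 + e * y.
  by apply: (addrI (P3 m (al ^+ 2) (0 ^+ 2) (fr al ^+ 2) e)); rewrite !addrA.
apply: char2_eq => //.
transitivity (X ^+ 2 + e * x + (Y ^+ 2 + e * y)); first by ring2 two0.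
by rewrite xy; ring2 two0.
Qed.

End CubicExtension.

Theorem theorem1 :
  exists m0 : nat, forall m : nat, (m0 <= m)%N ->
    forall F : finFieldType, #|F| = ((2 ^ m) ^ 3)%N ->
    forall a b c : F,
      planar (P3 m a b c) <-> (b = 0 /\ c = a ^+ (2 ^ m)).
Proof. by exists 3%N => m m3 F cardF a b c; exact: planar_P3. Qed.
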